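(* Let $(\mathcal C,p)$ be a universe category with universe $p:\widetilde U\to U$, let $CC=CC(\mathcal C,p)$ and let $n\ge 2$. The functions $\widetilde u_{n,\Gamma}:\widetilde{\mathcal{O}b}_n(\Gamma)\to D_p^{n-1}(Yo(\widetilde U))(int(\Gamma))$, $\Gamma\in CC$, defined by recursion on $n$ starting from $\widetilde u_1$ by $$\widetilde u_{m+1,\Gamma}(o)=(u_{1,\Gamma}(ft^m(\partial(o))),\,\widetilde u_{m,ft^m(\partial(o))}(o)),\qquad m\ge 1,$$ are well defined and form an isomorphism of presheaves on $CC$ $$\widetilde u_n:\widetilde{\mathcal{O}b}_n\to int^{\circ}(D_p^{n-1}(Yo(\widetilde U))).$$
   Context: Conventions. Composition is written in diagrammatic order: for $f:X\to Y$, $g:Y\to Z$ the composite is $f\circ g:X\to Z$. $\amalg_{i\in I}A_i$ denotes the set of pairs $(i,a)$, $i\in I$, $a\in A_i$. $Yo$ is the Yoneda embedding, $Yo(Y)(X)=Mor(X,Y)$. For a functor $\Phi:C\to C'$ and a presheaf $\mathcal G$ on $C'$, $\Phi^{\circ}(\mathcal G)(X)=\mathcal G(\Phi(X))$. For a morphism $p:Y\to X$, $sec(p)=\{s:X\to Y\mid s\circ p=Id_X\}$. Universes. A universe in a category $\mathcal C$ is a morphism $p:\widetilde U\to U$ with a choice, for every $F:X\to U$, of a pullback square with vertex $(X;F)$ and projections $p_F:(X;F)\to X$, $Q(F):(X;F)\to\widetilde U$, $p_F\circ F=Q(F)\circ p$. For $f:X'\to X$ and $F:X\to U$, $Q(f,F):(X';f\circ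 F)\to(X;F)$ is the unique morphism with $Q(f,F)\circ p_F=p_{f\circ F}\circ f$ and $Q(f,F)\circ Q(F)=Q(f\circ F)$. A universe category $(\mathcal C,p)$ is a category with a universe $p$ and a chosen final object $pt$. The functor $D_p:PreShv(\mathcal C)\to PreShv(\mathcal C)$. $D_p(\mathcal G)(X)=\amalg_{F:X\to U}\mathcal G((X;F))$; for $f:X'\to X$, $D_p(\mathcal G)(f)(F,\gamma)=(f\circ F,\mathcal G(Q(f,F))(\gamma))$; for $r:\mathcal G\to\mathcal G'$, $D_p(r)_X(F,\gamma)=(F,r_{(X;F)}(\gamma))$. $D_p^n$ is its $n$-th iterate, $D_p^0=Id$, $D_p^{n+1}(\mathcal G)=D_p(D_p^n(\mathcal G))$. The C-system $CC(\mathcal C,p)$. Define recursively sets $Ob_n(\mathcal C,p)$ and functions $int:Ob_n(\mathcal C,p)\to Ob(\mathcal C)$: $Ob_0(\mathcal C,p)=\{tt\}$, $int(tt)=pt$; $Ob_{n+1}(\mathcal C,p)=\amalg_{A\in Ob_n(\mathcal C,p)}Mor_{\mathcal C}(int(A),U)$, $int(A,F)=(int(A);F)$. Objects of $CC(\mathcal C,p)$ are pairs $\Gamma=(n,A)$ with $A\in Ob_n(\mathcal C,p)$, and $int(\Gamma)=int(A)$. Morphisms $\Gamma'\to\Gamma$ are (copies of) the morphisms $int(\Gamma')\to int(\Gamma)$ of $\mathcal C$, so that $int:CC(\mathcal C,p)\to\mathcal C$ is a fully faithful functor. Set $l(n,A)=n$, $ft(n+1,(A,F))=(n,A)$, $ft(0,tt)=(0,tt)$;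 for $T=(n+1,(A,F))$, $p_T:T\to ft(T)$ is the morphism with $int(p_T)=p_F$; for such $T$ and $f:(n',A')\to(n,A)$, $f^*(T)=(n'+1,(A',int(f)\circ F))$ and $q(f,T):f^*(T)\to T$ is the morphism with $int(q(f,T))=Q(int(f),F)$. The squares $p_{f^*(T)}\circ f=q(f,T)\circ p_T$ are pullbacks. Presheaves on $CC(\mathcal C,p)$. $\mathcal{O}b_n(\Gamma)=\{T\mid l(T)=l(\Gamma)+n,\ ft^n(T)=\Gamma\}$. For $f:\Gamma'\to\Gamma$ and $T\in\mathcal{O}b_n(\Gamma)$ define recursively in $n$: for $n=0$, $f^*(T)=\Gamma'$, $q(f,T)=f$; for $n\ge1$, $f^*(T)=q(f,ft(T))^*(T)$ and $q(f,T)=q(q(f,ft(T)),T)$. For $n\ge1$, $\widetilde{\mathcal{O}b}_n(\Gamma)$ is the set of morphisms $o$ with $\partial(o):=codom(o)\in\mathcal{O}b_n(\Gamma)$ and $o\in sec(p_{\partial(o)})$; for $f:\Gamma'\to\Gamma$, $\widetilde{\mathcal{O}b}_n(f)(o)=f^*(o)$ is the unique element of $sec(p_{f^*(\partial(o))})$ with $f^*(o)\circ q(f,\partial(o))=q(f,ft(\partial(o)))\circ o$. For $\Gamma=(n,A)$ and $T=(n+1,(A,F))\in\mathcal{O}b_1(\Gamma)$, $u_{1,\Gamma}(T)=F$; thus $int(T)=(int(\Gamma);u_{1,\Gamma}(T))$. The isomorphism $\widetilde u_1:\widetilde{\mathcal{O}b}_1\to int^\circ(Yo(\widetilde U))$ is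 given by $\widetilde u_{1,\Gamma}(o)=int(o)\circ Q(u_{1,\Gamma}(\partial(o)))$. *)

(* Defs.v *)
From mathcomp Require Import all_boot.
From Stdlib Require Import ClassicalEpsilon.

Set Implicit Arguments.
Unset Strict Implicit.
Unset Printing Implicit Defensive.
Set Primitive Projections.

Declare Scope cat_scope.
Delimit Scope cat_scope with cat.
Reserved Notation "f ;; g" (at level 50, left associativity).

(* Composition is in diagrammatic order.  Hom-types play the role of hom-sets:
   uniqueness of identity proofs follows from excluded middle. *)
Record category := Category {
  ob :> Type;
  mor : ob -> ob -> Type;
  idm : forall X, mor X X;
  comp : forall X Y Z, mor X Y -> mor Y Z -> mor X Z;
  comp1m : forall X Y (f : mor X Y), comp (idm X) f = f;
  compm1 : forall X Y (f : mor X Y), comp f (idm Y) = f;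
  compA : forall X Y Z W (f : mor X Y) (g : mor Y Z) (h : mor Z W),
    comp f (comp g h) = comp (comp f g) h }.

Arguments mor {c} X Y.
Arguments idm {c} X.
Arguments comp {c X Y Z} f g.
Notation "f ;; g" := (comp f g) : cat_scope.
Local Open Scope cat_scope.
#[local] Obligation Tactic := idtac.

Definition castm (C : category) (X X' Y Y' : C) (eX : X = X') (eY : Y = Y')
    (f : mor X Y) : mor X' Y' :=
  match eX in _ = X0, eY in _ = Y0 return mor X0 Y0 with
  | erefl, erefl => f
  end.

Record functor (C D : category) := Functor {
  fob :> C -> D;
  fmor : forall X Y, mor X Y -> mor (fob X) (fob Y);
  fmor1 : forall X, fmor (idm X) = idm (fob X);
  fmorM : forall X Y Z (f : mor X Y) (g : mor Y Z),
    fmor (f ;; g) = fmor f ;; fmor g }.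

Arguments fmor {C D} _ {X Y} _.

Record presheaf (C : category) := Presheaf {
  pob :> C -> Type;
  pres : forall X' X, mor X' X -> pob X -> pob X';
  pres1 : forall X (x : pob X), pres (idm X) x = x;
  presM : forall X'' X' X (g : mor X'' X') (f : mor X' X) (x : pob X),
    pres (g ;; f) x = pres g (pres f x) }.

Arguments pres {C} _ {X' X} _ _.

Record psh_hom (C : category) (G H : presheaf C) := PshHom {
  hom_at :> forall X, G X -> H X;
  hom_nat : forall X' X (f : mor X' X) (x : G X),
    hom_at (pres G f x) = pres H f (hom_at x) }.

Definition is_psh_iso (C : category) (G H : presheaf C) (phi : psh_hom G H) :=
  exists psi : psh_hom H G,
    (forall X (x : G X), psi X (phi X x) = x) /\
    (forall X (y : H X), phi X (psi X y) = y).

Definition Yo (C : category) (Y : C) : presheaf C :=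
  {| pob := fun X => mor X Y;
     pres := fun X' X f x => f ;; x;
     pres1 := fun X x => comp1m x;
     presM := fun X'' X' X g f x => esym (compA g f x) |}.

Program Definition pre_psh (C C' : category) (Phi : functor C C')
    (G : presheaf C') : presheaf C :=
  {| pob := fun X => G (Phi X);
     pres := fun X' X f x => pres G (fmor Phi f) x |}.
Next Obligation. by move=> * /=; rewrite fmor1 pres1. Qed.
Next Obligation. by move=> * /=; rewrite fmorM presM. Qed.

Definition is_pullback (C : category) (P X Y Z : C)
    (a : mor P X) (b : mor P Y) (f : mor X Z) (g : mor Y Z) :=
  a ;; f = b ;; g /\
  forall (W : C) (u : mor W X) (v : mor W Y), u ;; f = v ;; g ->
    exists! w : mor W P, w ;; a = u /\ w ;; b = v.

Definition is_final (C : category) (pt : C) :=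
  forall X : C, exists! f : mor X pt, True.

Record universe (C : category) := Universe {
  Utilde : C;
  U : C;
  pU : mor Utilde U;
  ext : forall X : C, mor X U -> C;
  pF : forall (X : C) (F : mor X U), mor (ext F) X;
  QF : forall (X : C) (F : mor X U), mor (ext F) Utilde;
  ext_pullback : forall (X : C) (F : mor X U),
    is_pullback (pF F) (QF F) F pU }.

Arguments ext {C u X} F.
Arguments pF {C u X} F.
Arguments QF {C u X} F.

Record universe_category := UniverseCategory {
  ucat :> category;
  univ : universe ucat;
  pt : ucat;
  pt_final : is_final pt }.

Section Dp.

Context {C : category} (u : universe C).

Lemma ext_sq (X : C) (F : mor X (U u)) : pF F ;; F = QF F ;; pU u.
Proof. by case: (ext_pullback F). Qed.

Lemma ext_uniq (X : C) (F : mor X (U u)) (W : C) (a b : mor W (ext F)) :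
  a ;; pF F = b ;; pF F -> a ;; QF F = b ;; QF F -> a = b.
Proof.
move=> ep eq; case: (ext_pullback F) => _ univF.
have [|w [_ uw]] := univF _ (b ;; pF F) (b ;; QF F).
  by rewrite -!compA ext_sq.
by rewrite -(uw a) // (uw b).
Qed.

Lemma Qfun_exists (X' X : C) (f : mor X' X) (F : mor X (U u)) :
  exists! q : mor (ext (f ;; F)) (ext F),
    q ;; pF F = pF (f ;; F) ;; f /\ q ;; QF F = QF (f ;; F).
Proof. by apply: (proj2 (ext_pullback F)); rewrite -compA ext_sq. Qed.

Definition Qfun (X' X : C) (f : mor X' X) (F : mor X (U u)) :
    mor (ext (f ;; F)) (ext F) :=
  proj1_sig (constructive_definite_description _ (Qfun_exists f F)).

Lemma Qfun_p (X' X : C) (f : mor X' X) (F : mor X (U u)) :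
  Qfun f F ;; pF F = pF (f ;; F) ;; f.
Proof. by rewrite /Qfun; case: constructive_definite_description => q []. Qed.

Lemma Qfun_Q (X' X : C) (f : mor X' X) (F : mor X (U u)) :
  Qfun f F ;; QF F = QF (f ;; F).
Proof. by rewrite /Qfun; case: constructive_definite_description => q []. Qed.

Lemma Dp_eq (G : presheaf C) (X Y : C) (h : mor X Y) (F' F'' : mor X (U u))
    (F : mor Y (U u)) (q' : mor (ext F') (ext F)) (q'' : mor (ext F'') (ext F))
    (x : G (ext F)) :
  F' = F'' -> q' ;; pF F = pF F' ;; h -> q' ;; QF F = QF F' ->
  q'' ;; pF F = pF F'' ;; h -> q'' ;; QF F = QF F'' ->
  existT (fun F0 : mor X (U u) => G (ext F0)) F' (pres G q' x) =
  existT (fun F0 : mor X (U u) => G (ext F0)) F'' (pres G q'' x).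
Proof.
move=> e; case: _ / e q'' => q'' p' Q' p'' Q''.
suff -> : q' = q'' by [].
by apply: ext_uniq; [rewrite p' p'' | rewrite Q' Q''].
Qed.

Program Definition Dp (G : presheaf C) : presheaf C :=
  {| pob := fun X => {F : mor X (U u) & G (ext F)};
     pres := fun X' X f x =>
       existT (fun F : mor X' (U u) => G (ext F))
         (f ;; projT1 x) (pres G (Qfun f (projT1 x)) (projT2 x)) |}.
Next Obligation.
move=> G X [F x] /=; rewrite -[in RHS](pres1 (p := G) x).
by apply: (@Dp_eq _ _ _ (idm X)); rewrite ?Qfun_p ?Qfun_Q ?comp1m ?compm1.
Qed.
Next Obligation.
move=> G X'' X' X g f [F x] /=; rewrite -presM.
apply: (@Dp_eq _ _ _ (g ;; f)).
- by rewrite compA.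
- by rewrite Qfun_p.
- by rewrite Qfun_Q.
- by rewrite -[LHS]compA Qfun_p [LHS]compA Qfun_p -[LHS]compA.
- by rewrite -compA !Qfun_Q.
Qed.

Fixpoint Dpn (n : nat) (G : presheaf C) : presheaf C :=
  if n is m.+1 then Dp (Dpn m G) else G.

End Dp.

Section CSystem.

Context (CU : universe_category).
Local Notation C := (ucat CU).
Local Notation u := (univ CU).

(* Ob_{n+1} depends on [int] on Ob_n, so both are built by one recursion. *)
Fixpoint Ob_int (n : nat) : {T : Type & T -> C} :=
  if n is m.+1 then
    existT (fun T : Type => T -> C)
      {A : projT1 (Ob_int m) & mor (projT2 (Ob_int m) A) (U u)}
      (fun AF => ext (projT2 AF))
  else existT (fun T : Type => T -> C) unit (fun _ => pt CU).

Arguments Ob_int : simpl never.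

Definition Ob (n : nat) : Type := projT1 (Ob_int n).
Definition intOb (n : nat) : Ob n -> C := projT2 (Ob_int n).

Record CCob := MkCCob { len : nat; ctx : Ob len }.

Definition int (T : CCob) : C := intOb (ctx T).

Definition CC : category :=
  {| ob := CCob;
     mor := fun X Y => mor (int X) (int Y);
     idm := fun X => idm (int X);
     comp := fun X Y Z f g => f ;; g;
     comp1m := fun X Y f => comp1m f;
     compm1 := fun X Y f => compm1 f;
     compA := fun X Y Z W f g h => compA f g h |}.

Definition int_functor : functor CC C :=
  {| fob := int : CC -> C;
     fmor := fun X Y f => f;
     fmor1 := fun X => erefl;
     fmorM := fun X Y Z f g => erefl |}.

Definition ftOb (n : nat) : Ob n -> Ob n.-1 :=
  if n is m.+1 return Ob n -> Ob n.-1 then fun A => projT1 A else id.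

Definition ft (T : CC) : CC := {| len := (len T).-1; ctx := ftOb (ctx T) |}.

(* Innermost application first, so that [ftn n.+1 T] is [ftn n (ft T)] *)
Fixpoint ftn (n : nat) (T : CC) : CC := if n is m.+1 then ftn m (ft T) else T.

Definition pOb (n : nat) : forall A : Ob n, mor (intOb A) (intOb (ftOb A)) :=
  match n with
  | 0 => fun A => idm _
  | m.+1 => fun A => pF (projT2 A)
  end.

(* In length 0, where [ft T = T], the only possible value is the identity of
   the final object. *)
Definition pT (T : CC) : mor T (ft T) := pOb (ctx T).

(* The last component [F] of [T = (n.+1, (A, F))] *)
Definition lastOb (n : nat) :
    forall A : Ob n, 0 < n -> mor (intOb (ftOb A)) (U u) :=
  match n with
  | 0 => fun A h => False_rect _ (Bool.diff_false_true h)
  | m.+1 => fun A _ => projT2 A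
  end.

Definition lastF (T : CC) (h : 0 < len T) : mor (int (ft T)) (U u) :=
  lastOb (ctx T) h.

Definition extCC (X : CC) (F : mor (int X) (U u)) : CC :=
  {| len := (len X).+1;
     ctx := existT (fun A => mor (intOb A) (U u)) (ctx X) F |}.

Lemma extCC_ind (P : forall T : CC, 0 < len T -> Prop) :
  (forall (X : CC) (F : mor (int X) (U u)), P (extCC F) isT) ->
  forall (T : CC) (h : 0 < len T), P T h.
Proof.
move=> Pext [[|n] A] // h; rewrite (bool_irrelevance h isT).
by by case: A h => A F _; exact: (Pext {| len := n; ctx := A |} F).
Qed.

(* [f^*(T)] and [q(f,T)] for [f : X -> ft T] and [T] of positive length *)
Definition pull1 (T : CC) (h : 0 < len T) (X : CC) (f : mor X (ft T)) : CC :=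
  extCC ((f : mor (int X) (int (ft T))) ;; lastF h).

Definition qOb (n : nat) : forall (A : Ob n) (h : 0 < n) (X : C)
    (f : mor X (intOb (ftOb A))), mor (ext (f ;; lastOb A h)) (intOb A) :=
  match n with
  | 0 => fun A h => False_rect _ (Bool.diff_false_true h)
  | m.+1 => fun A _ X f => Qfun f (projT2 A)
  end.

Definition q1 (T : CC) (h : 0 < len T) (X : CC) (f : mor X (ft T)) :
    mor (pull1 h f) T :=
  qOb h (f : mor (int X) (int (ft T))).

Lemma len_pos (n : nat) (T : CC) : n < len T -> 0 < len T.
Proof. exact: leq_ltn_trans. Qed.

Lemma len_ft (n : nat) (T : CC) : n < len T -> n <= len (ft T).
Proof. by rewrite /=; case: (len T). Qed.

(* The iterated [f^*(T)] and [q(f,T)] for [f : X -> ft^n T]; see [OOb_pull] for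
   [T] in Ob_n(X) *)
Fixpoint pullq (n : nat) : forall (T : CC), n <= len T ->
    forall X : CC, mor X (ftn n T) -> {T' : CC & mor T' T} :=
  match n with
  | 0 => fun T _ X f => existT (fun T' : CC => mor T' T) X f
  | m.+1 => fun T h X f =>
      let r := pullq (len_ft h) f in
      existT (fun T' : CC => mor T' T)
        (pull1 (len_pos h) (projT2 r)) (q1 (len_pos h) (projT2 r))
  end.

Record OOb (n : nat) (X : CC) : Type := MkOOb {
  obj : CC;
  obj_len : len obj = len X + n;
  obj_ftn : ftn n obj = X }.

(* A section of [p_T] has domain [ft T] and codomain [T], so an element of
   Obt_n(X) amounts to its boundary [T] in Ob_n(X) and a section of [p_T].
   Only 0 < n is meaningful. *)
Definition sec (T : CC) : Type := {o : mor (ft T) T | o ;; pT T = idm (ft T)}.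

Definition OObt (n : nat) (X : CC) : Type := {T : OOb n X & sec (obj T)}.

Definition bd (n : nat) (X : CC) (o : OObt n X) : OOb n X := projT1 o.

Lemma sec_pull_exists (T : CC) (h : 0 < len T) (X : CC) (f : mor X (ft T))
    (o : sec T) :
  exists! s : mor X (pull1 h f),
    s ;; pT (pull1 h f) = idm X /\ s ;; q1 h f = f ;; sval o.
Proof.
elim/extCC_ind: T / h f o => Z F f [o ho].
change (mor (int X) (int Z)) in f; change (mor (int Z) (ext F)) in o.
case: (ext_pullback (f ;; F)) => _.
case/(_ _ (idm (int X)) (f ;; (o ;; QF F))).
  rewrite comp1m -compA; congr (f ;; _); rewrite -compA -ext_sq compA.
  by move: ho => /= ->; rewrite comp1m.
move=> s [[sp sQ] us]; exists s; split.
  split=> //; apply: ext_uniq.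
    rewrite -[LHS]compA Qfun_p [LHS]compA sp comp1m -[RHS]compA.
    by move: ho => /= ->; rewrite compm1.
  by rewrite -[LHS]compA Qfun_Q sQ [LHS]compA.
move=> t [tp tq]; apply: us; split=> //.
by rewrite -(Qfun_Q f F) compA; move: tq => /= ->; rewrite compA.
Qed.

Definition sec_pull (T : CC) (h : 0 < len T) (X : CC) (f : mor X (ft T))
    (o : sec T) : sec (pull1 h f) :=
  let s := constructive_definite_description _ (sec_pull_exists h f o) in
  exist _ (sval s) (proj1 (proj2_sig s)).

Arguments sec_pull : simpl never.

Lemma sec_pullE (T : CC) (h : 0 < len T) (X : CC) (f : mor X (ft T))
    (o : sec T) : sval (sec_pull h f o) ;; q1 h f = f ;; sval o.
Proof.
by rewrite /sec_pull /=; case: constructive_definite_description => s [].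
Qed.

Lemma pullq_len (n : nat) (T : CC) (h : n <= len T) (X : CC)
    (f : mor X (ftn n T)) : len (projT1 (pullq h f)) = len X + n.
Proof.
elim: n T h f => [|n IHn] T h f /=; first by rewrite addn0.
by rewrite IHn addnS.
Qed.

Lemma pullq_ftn (n : nat) (T : CC) (h : n <= len T) (X : CC)
    (f : mor X (ftn n T)) : ftn n (projT1 (pullq h f)) = X.
Proof. elim: n T h f => [|n IHn] T h f //=; exact: IHn. Qed.

Lemma OOb_len (n : nat) (X : CC) (T : OOb n X) : n <= len (obj T).
Proof. by rewrite obj_len leq_addl. Qed.

(* [f : X' -> X] seen as a morphism into [ft^n T = X] *)
Definition to_ftn (n : nat) (X' X : CC) (T : OOb n X) (f : mor X' X) :
    mor X' (ftn n (obj T)) :=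
  castm erefl (esym (obj_ftn T)) f.

Definition OOb_pull (n : nat) (X' X : CC) (f : mor X' X) (T : OOb n X) :
    OOb n X' :=
  {| obj := projT1 (pullq (OOb_len T) (to_ftn T f));
     obj_len := pullq_len _ _;
     obj_ftn := pullq_ftn _ _ |}.

Definition OObt_pull (n : nat) : 0 < n -> forall (X' X : CC) (f : mor X' X),
    OObt n X -> OObt n X' :=
  match n with
  | 0 => fun h => False_rect _ (Bool.diff_false_true h)
  | m.+1 => fun _ X' X f o =>
      existT (fun T : OOb m.+1 X' => sec (obj T)) (OOb_pull f (bd o))
        (sec_pull (len_pos (OOb_len (bd o)))
           (projT2 (pullq (len_ft (OOb_len (bd o))) (to_ftn (bd o) f)))
           (projT2 o))
  end.

Lemma OObt_eq (n : nat) (X : CC) (a b : OObt n X) :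
  existT sec (obj (bd a)) (projT2 a) =
  existT sec (obj (bd b)) (projT2 b) -> a = b.
Proof.
have eq0 (p q : {T : CC & sec T}) : p = q -> forall lp fp lq fq,
    existT (fun T : OOb n X => sec (obj T))
      (MkOOb (obj := projT1 p) lp fp) (projT2 p) =
    existT (fun T : OOb n X => sec (obj T))
      (MkOOb (obj := projT1 q) lq fq) (projT2 q).
  move=> -> lp fp lq fq.
  rewrite (Classical_Prop.proof_irrelevance _ lp lq).
  by rewrite (Classical_Prop.proof_irrelevance _ fp fq).
by case: a b => [[T l f] o] [[T' l' f'] o'] /= e; exact: (eq0 _ _ e).
Qed.

Lemma sec_eq (T : CC) (o o' : sec T) : sval o = sval o' -> o = o'.
Proof.
case: o o' => [o h] [o' h'] /= e; case: _ / e h' => h'.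
by rewrite (Classical_Prop.proof_irrelevance _ h h').
Qed.

Definition step_q (T : CC) (h : 0 < len T) (r : {X : CC & mor X (ft T)}) :
    {T' : CC & mor T' T} :=
  existT (fun T' : CC => mor T' T) (pull1 h (projT2 r)) (q1 h (projT2 r)).

Definition step_s (T : CC) (h : 0 < len T) (o : sec T)
    (r : {X : CC & mor X (ft T)}) : {T' : CC & sec T'} :=
  existT sec (pull1 h (projT2 r)) (sec_pull h (projT2 r) o).

Lemma step_eq (X : CC) (F F' : mor (int X) (U u)) (Y : C) (G : mor Y (U u))
    (h : mor (int X) Y)
    (q : mor (ext F) (ext G)) (q' : mor (ext F') (ext G)) :
  F = F' -> q ;; pF G = pF F ;; h -> q' ;; pF G = pF F' ;; h ->
  q ;; QF G = QF F -> q' ;; QF G = QF F' ->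
  existT (fun T' : CC => mor (int T') (ext G)) (extCC F) q =
  existT (fun T' : CC => mor (int T') (ext G)) (extCC F') q'.
Proof.
move=> e; case: _ / e q' => q' p p' Q Q'.
suff -> : q = q' by [].
by apply: ext_uniq; [rewrite p p' | rewrite Q Q'].
Qed.

Lemma step_sec_eq (X : CC) (F F' : mor (int X) (U u)) (Y : C) (G : mor Y (U u))
    (s : sec (extCC F)) (s' : sec (extCC F'))
    (q : mor (ext F) (ext G)) (q' : mor (ext F') (ext G)) :
  F = F' -> q ;; QF G = QF F -> q' ;; QF G = QF F' ->
  (sval s : mor (int X) (ext F)) ;; q = (sval s' : mor (int X) (ext F')) ;; q' ->
  existT sec (extCC F) s = existT sec (extCC F') s'.
Proof.
move=> e; case: _ / e s' q' => s' q' Q Q' E.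
suff -> : s = s' by [].
apply/sec_eq/ext_uniq.
  exact: (etrans (proj2_sig s) (esym (proj2_sig s'))).
transitivity ((sval s : mor (int X) (ext F)) ;; q ;; QF G).
  by rewrite -[RHS]compA Q.
by rewrite E -[LHS]compA Q'.
Qed.

Lemma step_q_id (T : CC) (h : 0 < len T) :
  step_q h (existT (fun X : CC => mor X (ft T)) (ft T) (idm (ft T))) =
  existT (fun X : CC => mor X T) T (idm T).
Proof.
elim/extCC_ind: T / h => Z F.
apply: (@step_eq Z _ F (int Z) F (idm _)).
- by rewrite comp1m.
- by rewrite Qfun_p.
- by rewrite comp1m compm1.
- by rewrite Qfun_Q.
- by rewrite comp1m.
Qed.

Lemma step_s_id (T : CC) (h : 0 < len T) (o : sec T) :
  step_s h o (existT (fun X : CC => mor X (ft T)) (ft T) (idm (ft T))) =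
  existT sec T o.
Proof.
have E := sec_pullE h (idm (ft T)) o.
change (existT sec (pull1 h (idm (ft T))) (sec_pull h (idm (ft T)) o) =
  existT sec T o).
move: (sec_pull h _ o) E.
elim/extCC_ind: T / h o => Z F o s E.
apply: (@step_sec_eq Z _ F (int Z) F s o
  (Qfun (idm _) F) (idm _)).
- by rewrite /lastF /= comp1m.
- by rewrite Qfun_Q.
- by rewrite comp1m.
- by rewrite [RHS]compm1; exact: (etrans E (@comp1m CC _ _ _)).
Qed.

Lemma step_q_comp (T : CC) (h : 0 < len T) (X Y : CC) (f : mor X (ft T))
    (g : mor Y X) (h' : 0 < len (pull1 h f)) :
  step_q h (existT (fun X : CC => mor X (ft T)) Y (g ;; f)) =
  existT (fun X : CC => mor X T) (pull1 h' g) (q1 h' g ;; q1 h f).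
Proof.
elim/extCC_ind: T / h f h' => Z F f h'.
apply: (@step_eq Y _ _ (int Z) F ((g : mor (int Y) (int X)) ;; f)).
- by rewrite /lastF /= compA.
- by rewrite Qfun_p.
- by rewrite -[LHS]compA Qfun_p [LHS]compA Qfun_p [RHS]compA.
- by rewrite Qfun_Q.
- by rewrite -[LHS]compA !Qfun_Q.
Qed.

Lemma step_s_comp (T : CC) (h : 0 < len T) (o : sec T) (X Y : CC)
    (f : mor X (ft T)) (g : mor Y X) (h' : 0 < len (pull1 h f)) :
  step_s h o (existT (fun X : CC => mor X (ft T)) Y (g ;; f)) =
  existT sec (pull1 h' g) (sec_pull h' g (sec_pull h f o)).
Proof.
have E1 := sec_pullE h f o.
have E2 := sec_pullE h' g (sec_pull h f o).
have E3 := sec_pullE h (g ;; f) o.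
change (existT sec (pull1 h (g ;; f)) (sec_pull h (g ;; f) o) =
  existT sec (pull1 h' g) (sec_pull h' g (sec_pull h f o))).
move: (sec_pull h' g _) E2; move: (sec_pull h f o) E1.
move: (sec_pull h _ o) E3.
elim/extCC_ind: T / h o f h' => Z F o f h' s3 E3 s1 E1 s2 E2.
apply: (@step_sec_eq Y _ _ (int Z) F s3 s2
  (Qfun ((g : mor (int Y) (int X)) ;; f) F)
  (Qfun (g : mor (int Y) (int X)) ((f : mor (int X) (int Z)) ;; F)
     ;; Qfun (f : mor (int X) (int Z)) F)).
- by rewrite /lastF /= compA.
- by rewrite Qfun_Q.
- by rewrite -compA !Qfun_Q.
- rewrite [RHS]compA; apply: (etrans E3).
  apply: etrans (esym (f_equal (fun k => k ;; Qfun _ _) E2)).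
  rewrite -[RHS]compA; apply: etrans (f_equal (fun k => _ ;; k) (esym E1)).
  by rewrite [RHS]compA.
Qed.

Lemma pullq_id (n : nat) (T : CC) (h : n <= len T) :
  pullq h (idm (ftn n T)) = existT (fun X : CC => mor X T) T (idm T).
Proof.
elim: n T h => [|n IHn] T h //.
transitivity (step_q (len_pos h) (pullq (len_ft h) (idm (ftn n (ft T))))) => //.
by rewrite IHn step_q_id.
Qed.

Lemma pullq_comp (n : nat) (T : CC) (h : n <= len T) (X Y : CC)
    (f : mor X (ftn n T)) (g : mor Y X)
    (e : ftn n (projT1 (pullq h f)) = X)
    (h' : n <= len (projT1 (pullq h f))) :
  pullq h (g ;; f) =
  (let r := pullq h' (castm erefl (esym e) g) in
   existT (fun X : CC => mor X T) (projT1 r) (projT2 r ;; projT2 (pullq h f))).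
Proof.
elim: n T h f e h' => [|n IHn] T h f e h'.
  by rewrite /= (Classical_Prop.proof_irrelevance _ e erefl).
transitivity (step_q (len_pos h) (pullq (len_ft h) (g ;; f))) => //.
rewrite (IHn (ft T) (len_ft h) f e (len_ft h')).
exact: (@step_q_comp T (len_pos h) _ _ (projT2 (pullq (len_ft h) f))
  (projT2 (pullq (len_ft h') (castm erefl (esym e) g))) (len_pos h')).
Qed.

Program Definition OObt_psh (n : nat) (hn : 0 < n) : presheaf CC :=
  {| pob := fun X => OObt n X;
     pres := fun X' X f o => OObt_pull hn f o |}.
Next Obligation.
case=> [|n] // hn X [[T hl hT] o]; apply: OObt_eq.
destruct hT.
set a := existT _ _ _ : OObt n.+1 _; pose h := OOb_len (bd a).
change (step_s (len_pos h) o (pullq (len_ft h) (idm (ftn n (ft T)))) =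
  existT sec T o).
by rewrite pullq_id step_s_id.
Qed.
Next Obligation.
case=> [|n] // hn X'' X' X g f o0; apply: OObt_eq; move: o0 f.
case=> [[T hl hT] o]; destruct hT => f.
set a := existT _ _ _ : OObt n.+1 _.
pose h := OOb_len (bd a); pose b := OObt_pull hn f a.
pose h' := OOb_len (bd b).
pose e := obj_ftn (bd b).
change (step_s (len_pos h) o (pullq (len_ft h) (g ;; f)) =
  step_s (len_pos h') (sec_pull (len_pos h) (projT2 (pullq (len_ft h) f)) o)
    (pullq (len_ft h') (castm erefl (esym e) g))).
rewrite (@pullq_comp _ _ (len_ft h) _ _ f g e (len_ft h')).
exact: step_s_comp.
Qed.

Lemma ftnSr (n : nat) (T : CC) : ftn n.+1 T = ft (ftn n T).
Proof. elim: n T => [|n IHn] T //; exact: IHn. Qed.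

Lemma len_ftn (n : nat) (T : CC) : len (ftn n T) = len T - n.
Proof.
elim: n => [|n IHn]; first by rewrite subn0.
by rewrite ftnSr /= IHn subnS.
Qed.

Definition u1 (X : CC) (T : OOb 1 X) : mor (int X) (U u) :=
  castm (congr1 int (obj_ftn T)) erefl (lastF (OOb_len T)).

Lemma int_u1 (X : CC) (T : OOb 1 X) : int (obj T) = ext (u1 T).
Proof.
case: T => T hl hT; rewrite /u1 /=; move: (OOb_len _) => /= h.
case: _ / hT {hl} => /=.
by elim/extCC_ind: T / h.
Qed.

Lemma len_ftOOb (m : nat) (X : CC) (T : OOb m.+1 X) :
  len (ftn m (obj T)) = len X + 1.
Proof. by rewrite len_ftn obj_len -add1n addnA addnK. Qed.

(* [ft^m(T)] as an element of [Ob_1(X)], for [T] in [Ob_{m+1}(X)] *)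
Definition ftOOb (m : nat) (X : CC) (T : OOb m.+1 X) : OOb 1 X :=
  {| obj := ftn m (obj T);
     obj_len := len_ftOOb T;
     obj_ftn := etrans (esym (ftnSr m (obj T))) (obj_ftn T) |}.

Lemma len_rebase (m : nat) (X : CC) (T : OOb m.+1 X) :
  len (obj T) = len (ftn m (obj T)) + m.
Proof. by rewrite len_ftOOb obj_len -addnA add1n. Qed.

(* [o] in [Obt_{m+1}(X)] as an element of [Obt_m(ft^m(bd o))] *)
Definition rebase (m : nat) (X : CC) (o : OObt m.+1 X) :
    OObt m (obj (ftOOb (bd o))) :=
  existT (fun T : OOb m (ftn m (obj (bd o))) => sec (obj T))
    {| obj := obj (bd o); obj_len := len_rebase (bd o); obj_ftn := erefl |}
    (projT2 o).

Definition castp (G : presheaf C) (X X' : C) (e : X = X') (x : G X) : G X' :=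
  match e in _ = X0 return G X0 with erefl => x end.

Definition ut_family : Type :=
  forall n : nat, 0 < n -> forall X : CC,
    OObt n X -> Dpn u n.-1 (Yo (Utilde u)) (int X).

Definition ut1 (X : CC) (o : OObt 1 X) : mor (int X) (Utilde u) :=
  castm (congr1 int (obj_ftn (bd o))) (int_u1 (bd o)) (sval (projT2 o))
    ;; QF (u1 (bd o)).

(* The cast in the second component is along
   [int (ft^m (bd o)) = (int X; u1 (ft^m (bd o)))]. *)
Definition ut_recursion (v : ut_family) : Prop :=
  (forall (X : CC) (o : OObt 1 X), v 1 isT X o = ut1 o) /\
  (forall (k : nat) (X : CC) (o : OObt k.+2 X), let m := k.+1 in
    v m.+1 isT X o =
    existT (fun F : mor (int X) (U u) => Dpn u m.-1 (Yo (Utilde u)) (ext F))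
      (u1 (ftOOb (bd o)))
      (castp (int_u1 (ftOOb (bd o))) (v m isT (obj (ftOOb (bd o))) (rebase o)))).

End CSystem.

(* Main.v *)
Require Import Defs.
From mathcomp Require Import all_boot.
From Stdlib Require Import ClassicalEpsilon.

(** Write Z_F = (X;F) for the one-step extension of a context X by F : X -> U.
An element of Obt_{k+2}(X) is the same thing as a pair of a morphism
F : X -> U and an element of Obt_{k+1}(Z_F): the tower of extensions above X
begins with a single step to some Z_F, and the rest of the tower, with its
section, lies above Z_F ([glue], [glue_ind]).  Restriction along f : X' -> X
respects this decomposition: it sends (F, o) to (f;;F, Q(f,F)^* o)
([OObt_pull_glue]).  Points and restriction maps are thus given by the formulas
that define D_p, and each step of the recursion for [ut] is (F, o) |-> (F, ut o)
([ut_glue]), as for D_p of a morphism; naturality and bijectivity follow by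
induction.

The induction starts from Obt_1: a section s of p_F is the same thing as the
morphism s;;Q(F) : X -> Utilde, since F is recovered as s;;Q(F);;p and then s by
the universal property of the pullback ([ut_glue1], [glue1_inj], [sec_ofE]).

Presenting every element as [glue1] or [glue] also removes most of the transport
along equalities of contexts, because ft (extCC F) reduces to X. *)

Set Implicit Arguments.
Unset Strict Implicit.
Unset Printing Implicit Defensive.
Local Open Scope cat_scope.

Section UTilde.

Context (CU : universe_category).
Local Notation C := (ucat CU).
Local Notation u := (univ CU).
Local Notation CC := (CC CU).
Local Notation Ut := (Yo (Utilde u)).

Lemma castp_id (G : presheaf C) (X : C) (e : X = X) (x : G X) : castp e x = x.
Proof. by rewrite (Classical_Prop.proof_irrelevance _ e erefl). Qed.

Lemma extCC_of_ft (X T : CC) : 0 < len T -> ft T = X ->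
  exists F : mor (int X) (U u), T = extCC F.
Proof. by move=> h; case: _ /; elim/extCC_ind: T / h => Z F; exists F. Qed.

Definition glue1 (X : CC) (F : mor (int X) (U u)) (s : sec (extCC F)) :
    OObt 1 X :=
  existT (fun T : OOb 1 X => sec (obj T))
    (MkOOb (n := 1) (X := X) (obj := extCC F) (esym (addn1 _)) erefl) s.

Lemma glue_len (k : nat) (X : CC) (F : mor (int X) (U u)) (T : CC) :
  len T = len (extCC F) + k.+1 -> len T = len X + k.+2.
Proof. by move=> ->; rewrite addSnnS. Qed.

Lemma glue_ftn (k : nat) (X : CC) (F : mor (int X) (U u)) (T : CC) :
  ftn k.+1 T = extCC F -> ftn k.+2 T = X.
Proof. by move=> e; rewrite ftnSr e. Qed.

Definition glue (k : nat) (X : CC) (F : mor (int X) (U u))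
    (o : OObt k.+1 (extCC F)) : OObt k.+2 X :=
  existT (fun T : OOb k.+2 X => sec (obj T))
    (MkOOb (glue_len (obj_len (bd o))) (glue_ftn (obj_ftn (bd o)))) (projT2 o).

Lemma glue1_ind (X : CC) (P : OObt 1 X -> Prop) :
  (forall F (s : sec (extCC F)), P (glue1 s)) -> forall o, P o.
Proof.
move=> Pg [[T l e] s].
have h : 0 < len T by rewrite l addn1.
have [F eT] := extCC_of_ft h e; move: l e s {h}; rewrite eT => l e s.
suff -> : existT _ (MkOOb l e) s = glue1 s by exact: Pg.
exact: OObt_eq.
Qed.

Lemma glue_ind (k : nat) (X : CC) (P : OObt k.+2 X -> Prop) :
  (forall F (o : OObt k.+1 (extCC F)), P (glue o)) -> forall o, P o.
Proof.
move=> Pg [[T l e] s].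
have h : 0 < len (ftn k.+1 T).
  by rewrite len_ftn l (_ : k.+2 = 1 + k.+1) // addnA addnK addn1.
have [F eT] := extCC_of_ft h (etrans (esym (ftnSr k.+1 T)) e).
have l' : len T = len (extCC F) + k.+1 by rewrite l -addSnnS.
suff -> : existT _ (MkOOb l e) s =
    glue (existT (fun T => sec (obj T)) (MkOOb l' eT) s) by exact: Pg.
exact: OObt_eq.
Qed.

(** Pulling T back along f over k+1 levels amounts to pulling back only the
lowest level Z = ft^k(T), and then T over k levels along q(f,Z).  Here
ft^{k+1}(T) and ft(Z) agree only propositionally, hence the casts. *)
Lemma pullq_first (k : nat) (T Z X : CC) (hZ : 0 < len Z) (f : mor X (ft Z))
    (eZ : ftn k T = Z) (e : ftn k.+1 T = ft Z)
    (h : k < len T) (h' : k <= len T) :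
  pullq h (castm erefl (esym e) f) = pullq h' (castm erefl (esym eZ) (q1 hZ f)).
Proof.
elim: k T eZ e h h' => [|k IHk] T eZ e h h'.
  case: Z / eZ hZ f e => hZ f e.
  rewrite (Classical_Prop.proof_irrelevance _ e erefl) /=.
  by rewrite (bool_irrelevance (len_pos h) hZ).
transitivity (step_q (len_pos h)
  (pullq (n := k.+1) (len_ft h) (castm erefl (esym e) f))) => //.
rewrite (IHk (ft T) eZ e (len_ft h) (len_ft h')).
by rewrite (bool_irrelevance (len_pos h) (len_pos h')).
Qed.

Lemma OObt_pull_glue1 (X' X : CC) (f : mor X' X) (F : mor (int X) (U u))
    (s : sec (extCC F)) :
  OObt_pull (n := 1) isT f (glue1 s) =
  glue1 (sec_pull (T := extCC F) isT f s).
Proof.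
apply: OObt_eq => /=.
by rewrite (bool_irrelevance (len_pos _) (isT : 0 < len (extCC F))).
Qed.

(** The restriction map of D_p: the first component is composed with f, and the
second is restricted along q(f, extCC F), which is Q(f,F). *)
Lemma OObt_pull_glue (k : nat) (X' X : CC) (f : mor X' X)
    (F : mor (int X) (U u)) (o : OObt k.+1 (extCC F)) :
  OObt_pull (n := k.+2) isT f (glue o) =
  glue (OObt_pull (n := k.+1) isT (q1 (T := extCC F) isT f) o).
Proof.
apply: OObt_eq; case: o => [[T l e] s].
set a := existT _ _ _ : OObt k.+1 _.
pose h := OOb_len (bd (glue a)); pose h' := OOb_len (bd a).
pose e' := obj_ftn (bd (glue a)).
change (step_s (len_pos h) s
    (pullq (n := k.+1) (len_ft h) (castm erefl (esym e') f)) =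
  step_s (len_pos h') s
    (pullq (n := k) (len_ft h') (castm erefl (esym e)
      (q1 (T := extCC F) isT f)))).
rewrite (@pullq_first k (ft T) (extCC F) X' isT f e e' (len_ft h) (len_ft h')).
by rewrite (bool_irrelevance (len_pos h) (len_pos h')).
Qed.

Fixpoint ut (k : nat) : forall X : CC, OObt k.+1 X -> Dpn u k Ut (int X) :=
  match k with
  | 0 => fun X o => ut1 o
  | k.+1 => fun X o =>
      existT (fun F : mor (int X) (U u) => Dpn u k Ut (ext F))
        (u1 (ftOOb (bd o)))
        (castp (int_u1 (ftOOb (bd o))) (ut (rebase o)))
  end.

Definition sec_mor (X : CC) (F : mor (int X) (U u)) (s : sec (extCC F)) :
    mor (int X) (Utilde u) :=
  (sval s : mor (int X) (ext F)) ;; QF F.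

Lemma ut_glue1 (X : CC) (F : mor (int X) (U u)) (s : sec (extCC F)) :
  ut (glue1 s) = sec_mor s.
Proof.
rewrite /= /ut1 /sec_mor.
by rewrite (Classical_Prop.proof_irrelevance _ (int_u1 (bd (glue1 s))) erefl).
Qed.

(** Stated for an arbitrary y, so that T can be replaced by extCC F: in the
recursion for [ut] the value y depends on the whole tower above T. *)
Lemma u1_castp (G : presheaf C) (X : CC) (T : OOb 1 X)
    (F : mor (int X) (U u)) (e : obj T = extCC F) (y : G (int (obj T))) :
  existT (fun F : mor (int X) (U u) => G (ext F)) (u1 T) (castp (int_u1 T) y) =
  existT (fun F : mor (int X) (U u) => G (ext F)) F
    (castp (congr1 (@int CU) e) y).
Proof.
case: T e y => T l e1 /= e; rewrite -(esymK e).
move: (esym e) => {}e; case: T / e l e1 => l e1 y.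
rewrite (Classical_Prop.proof_irrelevance _ e1 erefl).
congr existT; exact: castp_id.
Qed.

Lemma ut_castp (k : nat) (T Z : CC) (e : ftn k.+1 T = Z)
    (l : len T = len (ftn k.+1 T) + k.+1) (l' : len T = len Z + k.+1)
    (s : sec T) :
  castp (congr1 (@int CU) e)
    (ut (existT (fun T => sec (obj T)) (MkOOb l erefl) s)) =
  ut (existT (fun T => sec (obj T)) (MkOOb l' e) s).
Proof.
by case: _ / e l' => l' /=; rewrite (Classical_Prop.proof_irrelevance _ l l').
Qed.

Lemma ut_glue (k : nat) (X : CC) (F : mor (int X) (U u))
    (o : OObt k.+1 (extCC F)) :
  ut (glue o) =
  existT (fun F : mor (int X) (U u) => Dpn u k Ut (ext F)) F (ut o).
Proof.
case: o => [[T l e] s]; set a := existT _ _ _.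
apply: etrans (@u1_castp (Dpn u k Ut) X (ftOOb (bd (glue a))) F e
  (ut (rebase (glue a)))) _.
congr existT; exact: (@ut_castp k T (extCC F) e (len_rebase (bd (glue a))) l s).
Qed.

Lemma sec_mor_pull (X' X : CC) (f : mor (int X') (int X))
    (F : mor (int X) (U u)) (s : sec (extCC F)) :
  sec_mor (sec_pull (T := extCC F) isT (f : mor X' X) s) = f ;; sec_mor s.
Proof.
have := sec_pullE (T := extCC F) isT (f : mor X' X) s.
move: (sec_pull _ _ _) => t E.
rewrite /sec_mor -(Qfun_Q f F) !Defs.compA.
exact: (f_equal (fun g => g ;; QF F) E).
Qed.

Lemma ut_nat (k : nat) (X' X : CC) (f : mor X' X) (o : OObt k.+1 X) :
  ut (OObt_pull (n := k.+1) isT f o) = pres (Dpn u k Ut) f (ut o).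
Proof.
elim: k X' X f o => [|k IHk] X' X f.
  elim/glue1_ind => F s; rewrite OObt_pull_glue1 !ut_glue1; exact: sec_mor_pull.
elim/glue_ind => F o; rewrite OObt_pull_glue !ut_glue IHk.
by [].
Qed.

Lemma sec_of_exists (X : CC) (g : mor (int X) (Utilde u)) :
  exists! s : mor (int X) (ext (g ;; pU u)),
    s ;; pF (g ;; pU u) = idm (int X) /\ s ;; QF (g ;; pU u) = g.
Proof. by apply: (proj2 (ext_pullback _)); rewrite comp1m. Qed.

Definition sec_of (X : CC) (g : mor (int X) (Utilde u)) :
    sec (extCC (X := X) (g ;; pU u)) :=
  let s := constructive_definite_description _ (sec_of_exists g) in
  exist _ (sval s) (proj1 (proj2_sig s)).

Lemma sec_ofE (X : CC) (g : mor (int X) (Utilde u)) :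
  sec_mor (sec_of g) = g.
Proof.
by rewrite /sec_mor /=; case: constructive_definite_description => s [].
Qed.

Fixpoint ut_inv (k : nat) : forall X : CC, Dpn u k Ut (int X) -> OObt k.+1 X :=
  match k with
  | 0 => fun X g => glue1 (sec_of g)
  | k.+1 => fun X y => glue (ut_inv (X := extCC (projT1 y)) (projT2 y))
  end.

(** The value s;;Q(F) determines F, which is s;;Q(F);;p because s is a section
of p_F, and then determines s, because the square of F is a pullback. *)
Lemma glue1_inj (X : CC) (F F' : mor (int X) (U u)) (s : sec (extCC F))
    (s' : sec (extCC F')) :
  sec_mor s = sec_mor s' -> glue1 s = glue1 s'.
Proof.
have secF (F0 : mor (int X) (U u)) (t : sec (extCC F0)) :
    F0 = sec_mor t ;; pU u.
  rewrite /sec_mor -Defs.compA -ext_sq Defs.compA.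
  by case: t => t /= ht; move: ht => /= ->; rewrite comp1m.
move=> E; have eF : F = F' by rewrite (secF F s) (secF F' s') E.
case: _ / eF s' E => s' E; congr glue1; apply/sec_eq/ext_uniq => //.
exact: etrans (proj2_sig s) (esym (proj2_sig s')).
Qed.

Lemma utK (k : nat) (X : CC) (o : OObt k.+1 X) : ut_inv (ut o) = o.
Proof.
elim: k X o => [|k IHk] X.
  by elim/glue1_ind => F s; rewrite ut_glue1; apply: glue1_inj; exact: sec_ofE.
by elim/glue_ind => F o; rewrite ut_glue /= IHk.
Qed.

Lemma ut_invK (k : nat) (X : CC) (y : Dpn u k Ut (int X)) : ut (ut_inv y) = y.
Proof.
elim: k X y => [|k IHk] X y.
  by rewrite ut_glue1; exact: sec_ofE.
case: y => F y.
exact: etrans (ut_glue _) (f_equal (existT _ F) (IHk (extCC F) y)).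
Qed.

Lemma bij_psh_hom_iso (D : category) (G H : presheaf D) (phi : psh_hom G H)
    (psi : forall X, H X -> G X) :
  (forall X, cancel (phi X) (psi X)) -> (forall X, cancel (psi X) (phi X)) ->
  is_psh_iso phi.
Proof.
move=> phiK psiK.
have psi_nat X' X (f : mor X' X) (y : H X) :
    psi X' (pres H f y) = pres G f (psi X y).
  by rewrite -{1}(psiK X y) -hom_nat phiK.
by exists (PshHom psi_nat); split.
Qed.

Definition ut_fam : ut_family CU := fun n =>
  match n return 0 < n -> forall X : CC, OObt n X -> Dpn u n.-1 Ut (int X) with
  | 0 => fun h => False_rect _ (Bool.diff_false_true h)
  | k.+1 => fun _ => @ut k
  end.

Lemma ut_fam_unique (v : ut_family CU) : ut_recursion v ->
  forall (n : nat) (hn : 0 < n) (X : CC) (o : OObt n X),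
    v n hn X o = ut_fam hn o.
Proof.
move=> [v1 vS] [|k] // hn X o; rewrite (bool_irrelevance hn isT) {hn}.
elim: k X o => [|k IHk] X o; first exact: v1.
by rewrite vS /= IHk.
Qed.

End UTilde.

Theorem mainTheorem7 (CU : universe_category) (n : nat) (hn : 1 < n) :
  exists v : ut_family CU,
    [/\ ut_recursion v,
        forall v' : ut_family CU, ut_recursion v' ->
          forall (m : nat) (hm : 0 < m) (X : CC CU) (o : OObt m X),
            v' m hm X o = v m hm X o
      & exists phi : psh_hom (OObt_psh CU (ltnW hn))
            (pre_psh (int_functor CU)
               (Dpn (univ CU) n.-1 (Yo (Utilde (univ CU))))),
          (forall (X : CC CU) (o : OObt n X), phi X o = v n (ltnW hn) X o) /\
          is_psh_iso phi].
Proof.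
exists (@ut_fam CU); split; [by split | exact: ut_fam_unique |].
case: n hn => // k hn; rewrite (bool_irrelevance (ltnW hn) isT).
pose phi : psh_hom (OObt_psh CU (n := k.+1) isT)
    (pre_psh (int_functor CU) (Dpn (univ CU) k (Yo (Utilde (univ CU))))) :=
  @PshHom _ (OObt_psh CU (n := k.+1) isT) (pre_psh (int_functor CU) _)
    (@ut CU k) (@ut_nat CU k).
exists phi; split=> //.
by apply: (@bij_psh_hom_iso _ _ _ phi (@ut_inv CU k)) => X;
  [exact: utK | exact: ut_invK].
Qed.
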